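(* Every $2$-arc-strong semicomplete digraph $D$ is eulerian-connected, that is, for any two distinct vertices $x,y$ of $D$, the digraph $D$ has a spanning $(x,y)$-trail.
   Context: Digraphs are finite, with no loops and no parallel arcs (two opposite arcs $xy$, $yx$ are allowed). A digraph is semicomplete if it has no pair of non-adjacent vertices. A digraph is strong if it contains an $(s,t)$-path for each ordered pair of distinct vertices $s,t$; it is $k$-arc-strong if it remains strong after the deletion of any set of at most $k-1$ arcs. A trail is a (directed) walk in which all arcs are distinct (vertices may repeat); an $(x,y)$-trail is a trail with initial vertex $x$ and terminal vertex $y$. It is spanning if it visits every vertex of $D$. *)

(* Defs.v *)
(* A digraph is a finType [T] of vertices with an irreflexive
   arc relation [e : rel T]; [e x y] is the arc xy, so parallel arcs are
   excluded by construction while opposite arcs are allowed. *)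
From mathcomp Require Import all_boot.

Set Implicit Arguments.
Unset Strict Implicit.
Unset Printing Implicit Defensive.

Section Digraph.

Variable T : finType.
Implicit Types (e : rel T) (x y s t : T) (p : seq T) (B : {set T * T}).

Definition arcs e : {set T * T} := [set a | e a.1 a.2].

Definition semicomplete e : Prop := forall x y, x != y -> e x y || e y x.

(* As in path.v, a walk is given by its first vertex [x] and the sequence [p]
   of the vertices that follow it. *)
Definition is_walk e x y p : Prop := path e x p /\ last x p = y.

Definition is_path e x y p : Prop := is_walk e x y p /\ uniq (x :: p).

Definition strong e : Prop :=
  forall s t, s != t -> exists p, is_path e s t p.

Definition delete_arcs e B : rel T := [rel x y | e x y && ((x, y) \notin B)].

Definition arc_strong (k : nat) e : Prop :=
  forall B, B \subset arcs e -> #|B| < k -> strong (delete_arcs e B).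

Definition walk_arcs x p : seq (T * T) := pairmap pair x p.

Definition is_trail e x y p : Prop := is_walk e x y p /\ uniq (walk_arcs x p).

Definition spanning x p : Prop := forall v : T, v \in x :: p.

Definition eulerian_connected e : Prop :=
  forall x y, x != y -> exists p, is_trail e x y p /\ spanning x p.

End Digraph.

(* Main.v *)
(* Extend an (x,y)-trail T as long as it misses a vertex.  A closed walk through
   a vertex of T, arc-disjoint from T, can be spliced into T; so can a vertex v
   off T with u -> v -> w for an arc uw of T.  If neither applies, every v off
   T with both in- and out-neighbours on T splits V(T) into an initial segment A
   with v -> A and a final segment B with B -> v, and T has a single arc a0b0
   from A to B.  By 2-arc-strength there is a path from A to B avoiding a0b0
   with interior off T; closing it up through v gives a closed walk that can be
   spliced.  Finally such a v exists: a path leaving T from a and returning to T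
   from v gives a closed walk if v -> a, and otherwise a -> v. *)
Require Import Defs.
From mathcomp Require Import all_boot.

Set Implicit Arguments.
Unset Strict Implicit.
Unset Printing Implicit Defensive.

(** * Arcs of walks, and cutting walks along a vertex predicate *)

Section Walks.

Variable T : finType.
Implicit Types (e : rel T) (x y u v w : T) (p q s : seq T) (A B P : pred T).

Lemma walk_arcs_cat x p q :
  walk_arcs x (p ++ q) = walk_arcs x p ++ walk_arcs (last x p) q.
Proof. exact: pairmap_cat. Qed.

Lemma walk_arcs_src x p u w : (u, w) \in walk_arcs x p -> u \in x :: p.
Proof.
elim: p x => [|z p IHp] x //=; rewrite !inE => /orP[/eqP[-> _]|/IHp].
  by rewrite eqxx.
by rewrite inE => ->; rewrite orbT.
Qed.

Lemma walk_arcs_tgt x p u w : (u, w) \in walk_arcs x p -> w \in p.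
Proof.
elim: p x => [|z p IHp] x //=; rewrite !inE => /orP[/eqP[_ ->]|/IHp->].
  by rewrite eqxx.
by rewrite orbT.
Qed.

Lemma uniq_walk_arcs x p : uniq p -> uniq (walk_arcs x p).
Proof.
elim: p x => [|z p IHp] x //= /andP[zNp /IHp->]; rewrite andbT.
by apply: contra zNp => /walk_arcs_tgt.
Qed.

Lemma walk_arcs_split x p u w : (u, w) \in walk_arcs x p ->
  exists p1 p2, p = p1 ++ w :: p2 /\ last x p1 = u.
Proof.
elim: p x => [|z p IHp] x //=; rewrite !inE => /orP[/eqP[-> ->]|/IHp].
  by exists [::], p.
by case=> p1 [p2 [-> <-]]; exists (z :: p1), p2.
Qed.

(** No arc of the walk enters [P] from outside, so a walk that has left [P] never returns to it. *)
Lemma walk_threshold P x p :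
    {in walk_arcs x p, forall a, P a.2 -> P a.1} ->
    has P (x :: p) -> has (predC P) (x :: p) ->
  exists p1 b p2,
    [/\ p = p1 ++ b :: p2, all P (x :: p1) & all (predC P) (b :: p2)].
Proof.
elim: p x => [|z p IHp] x stepP; first by rewrite /= !orbF => ->.
have stepP' : {in walk_arcs z p, forall a, P a.2 -> P a.1}.
  by move=> a a_in; apply: stepP; rewrite inE a_in orbT.
have Pzx : P z -> P x by apply: (stepP (x, z)); rewrite inE eqxx.
case Px: (P x) => hP hN; last first.
  have Pz : P z = false by apply/negP=> /Pzx; rewrite Px.
  have hP' : has P (z :: p) by move: hP; rewrite /= Px.
  have hN' : has (predC P) (z :: p) by rewrite /= Pz.
  have [p1 [b [p2 [_ /=]]]] := IHp z stepP' hP' hN'.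
  by rewrite Pz.
case Pz: (P z).
  have hP' : has P (z :: p) by rewrite /= Pz.
  have hN' : has (predC P) (z :: p) by move: hN; rewrite /= Px.
  have [p1 [b [p2 [-> all1 all2]]]] := IHp z stepP' hP' hN'.
  by exists (z :: p1), b, p2; split=> //=; rewrite Px.
exists [::], z, p; split=> //; first by rewrite /= Px.
case: (boolP (has P (z :: p))) => [hP'|]; last by rewrite all_predC.
have hN' : has (predC P) (z :: p) by rewrite /= Pz.
have [p1 [b [p2 [_ /=]]]] := IHp z stepP' hP' hN'.
by rewrite Pz.
Qed.

(** Take the first vertex [b] of the walk in [B] and the last vertex [a] in [A] before it. The
    [subseq] clause lets the segment inherit distinctness of vertices from [q]. *)
Lemma path_between e A B x q :
    path e x q -> A x -> ~~ B x -> B (last x q) ->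
  exists a s b, [/\ A a, B b, path e a (rcons s b),
    all (fun z => ~~ A z && ~~ B z) s & subseq (rcons s b) q].
Proof.
move=> e_q Ax Bx Bl.
pose out z := ~~ A z && ~~ B z.
(* Form suited to induction without [A x]: in the third case the segment reaches back to the current
   vertex and still lacks its start in [A]. *)
suff: [\/ B x, exists a s b, [/\ A a, B b, path e a (rcons s b), all out s
        & subseq (rcons s b) q]
      | exists s b, [/\ B b, path e x (rcons s b), all out s
        & subseq (rcons s b) q]].
  case=> [Bx'|//|[s [b [Bb e_s s_out sub]]]]; first by rewrite Bx' in Bx.
  by exists x, s, b.
elim: q x e_q Bl {Ax Bx} => [|z q IHq] x /=; first by move=> _; constructor 1.
case/andP=> e_xz e_q Bl; case Bz: (B z).
  by constructor 3; exists [::], z; rewrite /= e_xz eqxx sub0seq.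
case: (IHq z e_q Bl) => [|[a [s [b [Aa Bb e_s s_out sub]]]]
                         |[s [b [Bb e_s s_out sub]]]].
- by rewrite Bz.
- constructor 2; exists a, s, b; split=> //.
  exact: subseq_trans sub (subseq_cons _ _).
case Az: (A z).
  constructor 2; exists z, s, b; split=> //.
  exact: subseq_trans sub (subseq_cons _ _).
by constructor 3; exists (z :: s), b; rewrite /= /out e_xz Az Bz eqxx.
Qed.

End Walks.

(** * Enlarging the vertex set of a trail *)

Section Extension.

Variables (T : finType) (e : rel T) (x y : T) (p : seq T).
Hypothesis p_trail : is_trail e x y p.

(** Only the vertices of [p] must survive, not its arcs: [insert_vertex] gives up one arc. *)
Definition extendible : Prop :=
  exists q, [/\ is_trail e x y q, {subset x :: p <= x :: q}
    & exists2 v, v \in x :: q & v \notin x :: p].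

(** The closed walk is inserted at an occurrence of [u]. As [c] omits the start [u] but ends in it,
    [uniq c] makes the walk a cycle, so its arcs are distinct. *)
Lemma splice_closed_walk u c v :
    u \in x :: p -> path e u c -> last u c = u -> uniq c ->
    {in walk_arcs u c, forall a, a \notin walk_arcs x p} ->
    v \in c -> v \notin x :: p ->
  extendible.
Proof.
case: p_trail => -[e_p last_p] uniq_p u_in e_c last_c uniq_c disj v_in v_out.
have [p1 [p2 [p_eq u_last]]] : exists p1 p2, p = p1 ++ p2 /\ last x p1 = u.
  by case/splitPl: u_in => p1 p2 u_last; exists p1, p2.
rewrite p_eq in e_p last_p uniq_p disj v_out *.
exists (p1 ++ c ++ p2); split.
- split; first split.
  + by move: e_p; rewrite !cat_path u_last last_c e_c.
  + by rewrite !last_cat u_last last_c -u_last -last_cat.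
  + rewrite !walk_arcs_cat u_last last_c uniq_catCA cat_uniq.
    have <- : walk_arcs x (p1 ++ p2) = walk_arcs x p1 ++ walk_arcs u p2.
      by rewrite walk_arcs_cat u_last.
    rewrite uniq_walk_arcs //= uniq_p andbT.
    by apply/hasPn=> a a_p; apply/negP=> /disj; rewrite a_p.
- by move=> z; rewrite p_eq !inE !mem_cat => /or3P[] ->; rewrite ?orbT.
- by exists v; rewrite ?p_eq // !inE !mem_cat v_in !orbT.
Qed.

(** The arc [(u, w)] is replaced by [(u, v)] and [(v, w)], which are new to the trail since [v] is
    off it. *)
Lemma insert_vertex u v w :
  (u, w) \in walk_arcs x p -> e u v -> e v w -> v \notin x :: p -> extendible.
Proof.
case: p_trail => -[e_p last_p] uniq_p uw_in e_uv e_vw v_out.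
have [p1 [p2 [p_eq u_last]]] := walk_arcs_split uw_in.
have vwN : (v, w) \notin walk_arcs x p.
  by apply: contra v_out => /walk_arcs_src.
have uvN : (u, v) \notin walk_arcs x p.
  by apply: contra v_out => /walk_arcs_tgt; rewrite inE => ->; rewrite orbT.
have uv : u != v.
  by apply: contraNneq v_out => <-; apply: walk_arcs_src uw_in.
exists (p1 ++ v :: w :: p2); split.
- split; first split.
  + move: e_p; rewrite p_eq !cat_path /= u_last e_uv e_vw.
    by case/and3P=> -> _ ->.
  + by rewrite -last_p p_eq !last_cat.
  + have p_arcs : walk_arcs x p
        = walk_arcs x p1 ++ (u, w) :: walk_arcs w p2.
      by rewrite p_eq walk_arcs_cat /= u_last.
    move: uniq_p vwN uvN; rewrite p_arcs walk_arcs_cat /= u_last.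
    rewrite (uniq_catCA _ [:: (u, w)] (walk_arcs w p2)).
    rewrite (uniq_catCA _ [:: (u, v); (v, w)] (walk_arcs w p2)) /=.
    have uvw : (u, v) != (v, w) by rewrite xpair_eqE (negPf uv).
    rewrite !(mem_cat, inE) !negb_or uvw.
    by case/andP=> _ -> /and3P[-> _ ->] /and3P[-> _ ->].
- move=> z; rewrite p_eq !inE !mem_cat !inE => /or3P[->|->|/orP[]->];
  by rewrite ?orbT.
- by exists v; rewrite // !inE mem_cat inE eqxx !orbT.
Qed.

(** Every arc of the closed walk has an end off the trail, so it is not an arc of the trail.
    Shortening [s] first turns the closed walk into a cycle. *)
Lemma splice_outer_path u s :
    u \in x :: p -> path e u s -> s != [::] ->
    {in s, forall z, z \notin x :: p} -> e (last u s) u ->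
  extendible.
Proof.
move=> u_in e_s s_n0 s_out e_lu.
have l_in : last u s \in s by case: (s) s_n0 => //= z s' _; apply: mem_last.
have l_out := s_out _ l_in.
move: e_lu l_out; case: (shortenP e_s) => s' e_s' uniq_s' sub e_lu l_out.
have s'_out z : z \in s' -> z \notin x :: p by move/sub/s_out.
apply: (@splice_closed_walk u (rcons s' u) (last u s')) => //.
- by rewrite rcons_path e_s'.
- by rewrite last_rcons.
- by rewrite rcons_uniq.
- move=> [a b]; rewrite -cats1 walk_arcs_cat mem_cat => /orP[/walk_arcs_tgt|].
    move/s'_out; apply: contra => /walk_arcs_tgt b_in.
    by rewrite inE b_in orbT.
  rewrite inE => /eqP[-> _]; apply: contra l_out; exact: walk_arcs_src.
- rewrite mem_rcons; exact: mem_last.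
Qed.

(** * Extending a non-spanning trail by 2-arc-strength *)

Hypotheses (e_semicomplete : semicomplete e) (e_strong : arc_strong 2 e).

Lemma extend_at_mixed_vertex u v w :
    v \notin x :: p -> u \in x :: p -> w \in x :: p -> e u v -> e v w ->
  extendible.
Proof.
move=> v_out u_in w_in e_uv e_vw.
case: (boolP (has (fun z => e z v && e v z) (x :: p))).
  case/hasP=> z z_in /andP[e_zv e_vz].
  apply: (@splice_outer_path z [:: v]) => //=; first by rewrite e_zv.
  by move=> t; rewrite inE => /eqP->.
move/hasPn=> no2.
(* With 2-cycles through [v] and the trail excluded, exactly one arc joins [v] to each trail
   vertex. *)
have outE z : z \in x :: p -> ~~ e v z = e z v.
  move=> z_in; have zv : z != v by apply: contraNneq v_out => <-.
  by move: (no2 z z_in) (e_semicomplete zv); case: (e z v); case: (e v z).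
case: (boolP (has (fun a => e a.1 v && e v a.2) (walk_arcs x p))).
  case/hasP=> -[a b] ab_in /andP[e_av e_vb].
  by apply: (insert_vertex ab_in e_av).
move/hasPn=> no_ins.
have stepP : {in walk_arcs x p, forall a, e v a.2 -> e v a.1}.
  move=> [a b] ab_in /= e_vb; have := no_ins _ ab_in.
  by rewrite /= e_vb andbT -outE ?negbK // (walk_arcs_src ab_in).
have hP : has (e v) (x :: p) by apply/hasP; exists w.
have hN : has (predC (e v)) (x :: p) by apply/hasP; exists u; rewrite //= outE.
have [p1 [b0 [p2 [p_eq /allP all1 /allP all2]]]] := walk_threshold stepP hP hN.
case: p_trail => -[e_p last_p] uniq_p.
set a0 := last x p1.
(* Any other arc of the trail has its head in [p1] or its tail in [b0 :: p2], so it cannot go from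
   out-neighbours of [v] to in-neighbours. *)
have a0b0_only a b : (a, b) \in walk_arcs x p -> e v a -> ~~ e v b ->
    (a, b) = (a0, b0).
  rewrite p_eq walk_arcs_cat mem_cat /= inE.
  case/or3P=> [/walk_arcs_tgt b_in|/eqP->//|/walk_arcs_src a_in] e_va e_vb.
    by rewrite all1 ?inE ?b_in ?orbT in e_vb.
  by have := all2 _ a_in; rewrite /= e_va.
have e_vx : e v x by apply: all1; rewrite mem_head.
have e_vy : ~~ e v y.
  by apply: all2; rewrite -last_p p_eq last_cat /= mem_last.
have y_in : y \in x :: p by rewrite -last_p mem_last.
have xy : x != y by apply: contraNneq e_vy => <-.
have a0b0_arc : [set (a0, b0)] \subset arcs e.
  rewrite sub1set inE /=; move: e_p.
  by rewrite p_eq cat_path /= => /and3P[].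
have card1 : #|[set (a0, b0)]| < 2 by rewrite cards1.
(* The ends [x] and [y] lie on different sides of the threshold, so this path must cross it without
   using [(a0, b0)]. *)
have [q [[e_q last_q] /= /andP[_ uniq_q]]] := e_strong a0b0_arc card1 xy.
pose A z := (z \in x :: p) && e v z; pose B z := (z \in x :: p) && ~~ e v z.
have [a [s [b []]]] : exists a s b, [/\ A a, B b,
    path (delete_arcs e [set (a0, b0)]) a (rcons s b),
    all (fun z => ~~ A z && ~~ B z) s & subseq (rcons s b) q].
  apply: (@path_between _ _ A B x q) => //; first by rewrite /A mem_head.
    by rewrite /B e_vx andbF.
  by rewrite last_q /B y_in.
case/andP=> a_in e_va /andP[b_in e_vb] e'_s /allP s_out' sub.
have s_out z : z \in s -> z \notin x :: p.
  by move/s_out'; rewrite /A /B; case: (z \in x :: p) => //=; case: (e v z).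
have e_s : path e a (rcons s b) by apply: sub_path e'_s => ? ? /andP[].
(* If the crossing segment meets [v], its part up to [v] already closes up through the arc from [v]
   to [a]. *)
have [v_in|v_s] := boolP (v \in s).
  move: e_s s_out; case/splitPr: v_in => s1 s2 e_s s_out.
  apply: (@splice_outer_path a (rcons s1 v)) => //.
  - by move: e_s; rewrite rcons_cat -cat_rcons cat_path => /andP[].
  - by case: (s1).
  - move=> z; rewrite mem_rcons inE => /predU1P[->//|z_in].
    by apply: s_out; rewrite mem_cat z_in.
  - by rewrite last_rcons.
have e_bv : e b v by rewrite -outE.
have uniq_s : uniq s.
  by have := subseq_uniq sub uniq_q; rewrite rcons_uniq => /andP[].
have av : a != v by apply: contraNneq v_out => <-.
have bv : b != v by apply: contraNneq v_out => <-.
have ba : b != a by apply: contraNneq e_vb => ->.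
have in_outF z : z \in x :: p -> z \in s = false.
  by move=> z_in; apply/negP=> /s_out; rewrite z_in.
apply: (@splice_closed_walk a (rcons s b ++ [:: v; a]) v) => //.
- by rewrite cat_path e_s last_rcons /= e_bv e_va.
- by rewrite last_cat.
- rewrite cat_rcons cat_uniq uniq_s /= !inE !negb_or bv ba (eq_sym v) av.
  by rewrite (in_outF b) // (in_outF a) // (negPf v_s).
- move=> [z t]; rewrite cat_rcons walk_arcs_cat mem_cat /= !inE.
  case/or4P=> [/walk_arcs_tgt/s_out|/eqP zt|/eqP[_ ->]|/eqP[-> _]].
  + by apply: contra => /walk_arcs_tgt t_in; rewrite inE t_in orbT.
  (* The arc into [b] is the only doubtful one. Were it on the trail, its tail would be [a], as [s]
     is off the trail; it would then be [(a0, b0)], which was deleted. *)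
  + apply/negP=> zt_in; case: zt => zl tb.
    have := mem_last a s; rewrite -zl inE in_outF ?(walk_arcs_src zt_in) //.
    rewrite orbF => /eqP za; rewrite za tb in zl zt_in.
    move: e'_s; rewrite rcons_path -zl /delete_arcs /= inE.
    by rewrite (a0b0_only _ _ zt_in e_va e_vb) eqxx andbF andbF.
  + by apply: contra v_out => /walk_arcs_tgt v_in; rewrite inE v_in orbT.
  + by apply: contra v_out => /walk_arcs_src.
- by rewrite mem_cat inE eqxx orbT.
Qed.

Lemma nonspanning_extendible v : v \notin x :: p -> extendible.
Proof.
move=> v_out.
have vx : v != x by apply: contraNneq v_out => ->; rewrite mem_head.
have e_path s t : s != t -> exists2 q, path e s q & last s q = t.
  move=> st; have [|q [[e_q l_q] _]] := e_strong (sub0set _) _ st.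
    by rewrite cards0.
  by exists q => //; apply: sub_path e_q => ? ? /andP[].
have [|q1 e_q1 last_q1] := e_path x v; first by rewrite eq_sym.
have [q2 e_q2 last_q2] := e_path v x vx.
have [a [s1 [v' [a_in /eqP-> e_s1 /allP s1_out _]]]] :
  exists a s b, [/\ a \in x :: p, b == v, path e a (rcons s b),
    all (fun z => (z \notin x :: p) && (z != v)) s & subseq (rcons s b) q1].
  apply: (@path_between _ e (mem (x :: p)) (pred1 v) x q1) => //=.
  - by rewrite inE eqxx.
  - by rewrite eq_sym.
  - by rewrite last_q1.
have [v'' [s2 [b [/eqP-> b_in e_s2 /allP s2_out _]]]] :
  exists a s b, [/\ a == v, b \in x :: p, path e a (rcons s b),
    all (fun z => (z != v) && (z \notin x :: p)) s & subseq (rcons s b) q2].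
  apply: (@path_between _ e (pred1 v) (mem (x :: p)) v q2) => //=.
  by rewrite last_q2 inE eqxx.
(* [s] is the whole excursion off the trail, between [a] and [b]; [r], its last vertex, may differ
   from [v]. *)
pose s := rcons s1 v ++ s2; pose r := last a s.
have r_last : r = last v s2 by rewrite /r /s last_cat last_rcons.
have s_out : {in s, forall z, z \notin x :: p}.
  move=> z; rewrite mem_cat mem_rcons inE -orbA.
  by case/or3P=> [/eqP->//|/s1_out/andP[]|/s2_out/andP[]].
have r_out : r \notin x :: p.
  apply: s_out; rewrite r_last mem_cat mem_rcons inE.
  by have := mem_last v s2; rewrite inE => /orP[->|->] //; rewrite orbT.
move: e_s2; rewrite rcons_path -r_last => /andP[e_s2 e_rb].
have [e_ra|e_raN] := boolP (e r a).
  apply: (@splice_outer_path a s) => //; last by rewrite /s; case: (s1).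
  by rewrite cat_path e_s1 last_rcons.
apply: (extend_at_mixed_vertex r_out a_in b_in _ e_rb).
have ra : r != a by apply: contraNneq r_out => ->.
by have := e_semicomplete ra; rewrite (negPf e_raN).
Qed.

End Extension.

Theorem theorem9 (T : finType) (e : rel T) (e_irr : irreflexive e)
    (e_semicomplete : semicomplete e) (e_strong : arc_strong 2 e) :
  eulerian_connected e.
Proof.
move=> x y xy.
have [p0 p0_trail] : exists p, is_trail e x y p.
  have [|p [[e_p l_p] u_p]] := e_strong _ (sub0set _) _ _ _ xy.
    by rewrite cards0.
  exists p; split; last by apply: uniq_walk_arcs; case/andP: u_p.
  by split=> //; apply: sub_path e_p => ? ? /andP[].
(* Induction on the number of vertices missed by the trail. *)
have [n] := ubnP #|[predC x :: p0]|.
elim: n p0 p0_trail => // n IHn p p_trail le_n.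
have [/forallP p_span|/forallPn[v v_out]] := boolP [forall v, v \in x :: p].
  by exists p.
have [q [q_trail sub [w w_in w_out]]] :=
  nonspanning_extendible p_trail e_semicomplete e_strong v_out.
apply: (IHn q q_trail); apply: leq_trans (proper_card _) le_n.
apply/properP; split; last by exists w; rewrite inE /= ?w_in.
by apply/subsetP=> z; apply: contra => /sub.
Qed.
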